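(* Let $\mathcal{H}=(V,E)$ be a hypergraph with co-rank $s$, $|V|=n$ and average degree $d(\mathcal{H})$. Then $$\mathcal{E}(\mathcal{H})\ge \sqrt{2n(s-1)d(\mathcal{H})}.$$ Equality holds if and only if $\mathcal{H}$ is $2$-uniform and has at most one connected component containing an edge, that component being a complete bipartite graph (all remaining vertices being isolated).
   Context: A hypergraph $\mathcal{H}=(V,E)$ consists of a finite vertex set $V$ and a set $E$ of edges, each edge being a subset of $V$ of cardinality at least $2$ (distinct edges are distinct subsets). It is $2$-uniform if every edge has exactly $2$ vertices (i.e., it is a simple graph). The co-rank of $\mathcal{H}$ is the smallest cardinality of an edge (for an edgeless hypergraph both sides are $0$). For $\alpha\subseteq V$, $d(\alpha)$ is the number of edges containing all vertices of $\alpha$; the degree of $v$ is $d(v)=d(\{v\})$, and $d(\mathcal{H})=\frac{1}{|V|}\sum_{v}d(v)$. A walk is a sequence $v_0e_1v_1\dots e_lv_l$ where $v_{i-1},v_i$ are distinct vertices of the edge $e_i$; connected components are defined via walks. The adjacency matrix $\mathbf{A}(\mathcal{H})$ is the $n\times n$ matrix with zero diagonal and $(i,j)$ entry $d(\{i,j\})$ for $i\neq j$. The energy is $\mathcal{E}(\mathcal{H})=\sum_{i=1}^n|\lambda_i|$, where $\lambda_1\ge\dots\ge\lambda_n$ are the eigenvalues of $\mathbf{A}(\mathcal{H})$. *)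

(* Defs.v *)
From HB Require Import structures.
From mathcomp Require Import all_boot all_order all_algebra.
From mathcomp Require Import complex.

Set Implicit Arguments.
Unset Strict Implicit.
Unset Printing Implicit Defensive.

Import Order.TTheory GRing.Theory Num.Theory.

Record hypergraph (V : finType) := Hypergraph {
  edges : {set {set V}};
  edge_card : forall e : {set V}, e \in edges -> 2 <= #|e|
}.

Section Combinatorics.
Variables (V : finType) (H : hypergraph V).

Definition uniform (k : nat) : Prop :=
  forall e : {set V}, e \in edges H -> #|e| = k.

(* The default #|V| of the minimum is an upper bound for every edge size, so it
   only shows for an edgeless hypergraph, which has no smallest edge; there the
   average degree is 0, so the default does not affect a product of the two. *)
Definition corank : nat := \big[minn/#|V|]_(e in edges H) #|e|.

Definition codegree (A : {set V}) : nat := #|[set e in edges H | A \subset e]|.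

Definition degree (v : V) : nat := codegree [set v].

(* A walk from v, given by its successive pairs (e_i, v_i). *)
Fixpoint walk (v : V) (p : seq ({set V} * V)) : bool :=
  if p is (e, w) :: p' then
    [&& e \in edges H, v \in e, w \in e, v != w & walk w p']
  else true.

(* The connected components are the classes of the relation "some walk joins
   v to w"; [connect step] decides that relation, see [connectedP]. *)
Definition step : rel V :=
  fun v w => [exists e in edges H, [&& v \in e, w \in e & v != w]].

Definition connected (v w : V) : bool := connect step v w.

Lemma connectedP (v w : V) :
  reflect (exists2 p, walk v p & last v (unzip2 p) = w) (connected v w).
Proof.
apply: (iffP connectP) => [[p]|[p]].
  elim: p v => [|x p IHp] v /=; first by move=> _ ->; exists [::].
  case/andP=> /exists_inP[e eH /and3P[ve xe vx]] px wE.
  by have [q wq <-] := IHp x px wE; exists ((e, x) :: q); rewrite //= eH ve xe vx.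
elim: p v => [|[e x] p IHp] v /=; first by move=> _ ->; exists [::].
case/and5P=> eH ve xe vx wp wE; have [q pq ->] := IHp x wp wE.
exists (x :: q) => //=; rewrite pq andbT.
by apply/exists_inP; exists e; rewrite // ve xe.
Qed.

Definition components : {set {set V}} :=
  equivalence_partition connected [set: V].

Definition edges_in (C : {set V}) : {set {set V}} :=
  [set e in edges H | e \subset C].

Definition nontrivial_components : {set {set V}} :=
  [set C in components | edges_in C != set0].

Definition complete_bipartite (C : {set V}) : Prop :=
  exists X Y : {set V},
    [/\ X != set0, Y != set0, X :|: Y = C, [disjoint X & Y]
      & edges_in C = [set [set x; y] | x in X, y in Y]].

Definition isolated (v : V) : Prop := degree v = 0.

End Combinatorics.

Local Open Scope ring_scope.

(* 0 when V is empty, since 0^-1 = 0. *)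
Definition average_degree (R : rcfType) (V : finType) (H : hypergraph V) : R :=
  #|V|%:R^-1 * \sum_(v : V) (degree H v)%:R.

(* Vertices index the rows and columns through the enumeration of V. *)
Definition adjmx (R : rcfType) (V : finType) (H : hypergraph V) :
    'M[R]_#|V| :=
  \matrix_(i, j)
    if i == j then 0 else (codegree H [set enum_val i; enum_val j])%:R.

Lemma adjmx_sym (R : rcfType) (V : finType) (H : hypergraph V) :
  (adjmx R H)^T = adjmx R H.
Proof. by apply/matrixP=> i j; rewrite !mxE eq_sym setUC. Qed.

Lemma sym_eigenvalues (R : rcfType) n (A : 'M[R]_n) : A^T = A ->
  {r : seq R | sorted >=%R r & char_poly A = \prod_(x <- r) ('X - x%:P)}.
Proof.
move=> symA; pose f := real_complex R; pose B := map_mx f A.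
have fR x : f x \is Num.real by rewrite complex_real.
have hB : B \is hermsymmx.
  apply: realsym_hermsym; last by apply/mxOverP=> i j; rewrite mxE fR.
  by apply/is_hermitianmxP; rewrite expr0 scale1r map_mx_id // map_trmx symA.
set d := spectral_diag B.
have dR i : d 0 i \is Num.real.
  by have /mxOverP := hermitian_spectral_diag_real hB; apply.
have defB := orthomx_spectralP (hermitian_normalmx hB).
set P := spectralmx B in defB; rewrite -/d in defB.
have uP : P \in unitmx := spectral_unit B.
pose r := [seq complex.Re (d 0 i) | i <- enum 'I_n].
exists (sort >=%R r); first by apply: sort_sorted => x y; apply: ge_total.
rewrite (perm_big r) ?perm_sort //=.
apply: (map_poly_inj (real_complex R)).
rewrite map_char_poly -/f -/B rmorph_prod big_map big_enum /=.
have -> : char_poly B = char_poly (diag_mx d).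
  rewrite /char_poly /char_poly_mx {1}defB.
  set Q := map_mx polyC P; set Q' := map_mx polyC (invmx P).
  have QQ : Q' *m Q = 1%:M by rewrite -map_mxM mulVmx // map_mx1.
  have -> : 'X%:M - map_mx polyC (invmx P *m diag_mx d *m P)
      = Q' *m ('X%:M - map_mx polyC (diag_mx d)) *m Q.
    rewrite !map_mxM mulmxBr mulmxBl -/Q -/Q'; congr (_ - _).
    by rewrite mul_mx_scalar -scalemxAl QQ scalemx1.
  by rewrite !det_mulmx mulrAC -det_mulmx QQ det1 mul1r.
rewrite char_poly_trig ?diag_mx_is_trig //; apply: eq_bigr => i _.
rewrite !mxE eqxx mulr1n rmorphB /= map_polyX map_polyC /=.
by rewrite -/f /f RRe_real.
Qed.

(* The eigenvalues, with algebraic multiplicity, in non-increasing order. *)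
Definition spectrum (R : rcfType) (V : finType) (H : hypergraph V) : seq R :=
  s2val (sym_eigenvalues (adjmx_sym R H)).

Definition energy (R : rcfType) (V : finType) (H : hypergraph V) : R :=
  \sum_(x <- spectrum R H) `|x|.

(* Main.v *)
(* The eigenvalues x sum to tr A = 0, so 2|x| <= E for each of them; summing
   x^2 <= |x| E/2 gives E^2 >= 2 tr A^2. As A has natural entries, tr A^2 is at
   least the sum of its entries, i.e. the sum of |e|(|e|-1) over the edges, which
   is at least (s-1) times the sum of the degrees.
   In the case of equality A is a 0/1 matrix and |x| is 0 or E/2, so A^3 = c A
   with 2c = tr A^2. Then tr A^3 = 0 rules out triangles, hence edges with three
   vertices, and counting the walks of length 3 between the ends of an edge [ab]
   shows that every edge [xy] satisfies a~x, y~b or a~y, x~b: the nonempty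
   component is complete bipartite with parts N(b) and N(a).
   Conversely, for parts X and Y, A^3 = |X||Y| A and tr A^2 = 2|X||Y|, so
   sqrt(|X||Y|) |x| = x^2 for each eigenvalue, which gives E^2 = 2 tr A^2. *)
Require Import Defs.
From HB Require Import structures.
From mathcomp Require Import all_boot all_order all_algebra.
From mathcomp Require Import complex.
From mathcomp Require Import zify ring lra.
Import Order.TTheory GRing.Theory Num.Theory.
Set Implicit Arguments.
Unset Strict Implicit.
Unset Printing Implicit Defensive.

Local Open Scope ring_scope.

(** * Diagonalization and traces of real symmetric matrices *)

Lemma char_poly_similar (F : comUnitRingType) n (P A : 'M[F]_n) :
  P \in unitmx -> char_poly (invmx P *m A *m P) = char_poly A.
Proof.
move=> uP; rewrite /char_poly /char_poly_mx.
set Q := map_mx polyC P; set Q' := map_mx polyC (invmx P).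
have QQ : Q' *m Q = 1%:M by rewrite -map_mxM mulVmx // map_mx1.
have -> : 'X%:M - map_mx polyC (invmx P *m A *m P)
    = Q' *m ('X%:M - map_mx polyC A) *m Q.
  rewrite !map_mxM mulmxBr mulmxBl -/Q -/Q'; congr (_ - _).
  by rewrite mul_mx_scalar -scalemxAl QQ scalemx1.
by rewrite !det_mulmx mulrAC -det_mulmx QQ det1 mul1r.
Qed.

Lemma similar_diag_cube (F : fieldType) n (P B : 'M[F]_n) (d : 'rV_n) (c : F) :
    P \in unitmx -> B = invmx P *m diag_mx d *m P ->
  B *m B *m B - c *: B =
    invmx P *m diag_mx (\row_i (d 0 i ^+ 3 - c * d 0 i)) *m P.
Proof.
move=> uP ->; rewrite !mulmxA !mulmxK //.
have -> : diag_mx (\row_i (d 0 i ^+ 3 - c * d 0 i)) =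
    diag_mx d *m diag_mx d *m diag_mx d - c *: diag_mx d.
  rewrite !mulmx_diag -linearZ -linearB; congr diag_mx.
  by apply/rowP=> i; rewrite !mxE; ring.
by rewrite mulmxBr mulmxBl -scalemxAr -scalemxAl !mulmxA.
Qed.

Section SymmetricSpectrum.
Variables (R : rcfType) (n : nat) (A : 'M[R]_n) (r : seq R).
Hypotheses (symA : A^T = A) (charA : char_poly A = \prod_(x <- r) ('X - x%:P)).
Let f := real_complex R.

(** Over [R[i]] a real symmetric matrix is Hermitian, so the spectral theorem diagonalizes it.
    Unique factorization of the characteristic polynomial then matches [r] with the diagonal up to
    order. *)
Lemma sym_diagonalization : exists P : 'M[R[i]]_n, exists d : 'rV[R[i]]_n,
  [/\ P \in unitmx, map_mx f A = invmx P *m diag_mx d *m P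
    & perm_eq (map f r) [seq d 0 i | i <- enum 'I_n]].
Proof.
have fR x : f x \is Num.real by rewrite complex_real.
have hB : map_mx f A \is hermsymmx.
  apply: realsym_hermsym; last by apply/mxOverP=> i j; rewrite mxE fR.
  by apply/is_hermitianmxP; rewrite expr0 scale1r map_mx_id // map_trmx symA.
have defB := orthomx_spectralP (hermitian_normalmx hB).
exists (spectralmx (map_mx f A)), (spectral_diag (map_mx f A)).
split=> //; first exact: spectral_unit.
apply: prod_XsubC_eq; rewrite 2!big_map big_enum /=.
have := congr1 (map_poly f) charA.
rewrite map_char_poly {1}defB char_poly_similar ?spectral_unit //.
rewrite char_poly_trig ?diag_mx_is_trig // rmorph_prod /=.
under eq_bigr do rewrite !mxE eqxx mulr1n.
under [X in _ = X -> _]eq_bigr do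
  rewrite rmorphB /= map_polyX map_polyC /=.
by move->.
Qed.

Lemma sym_trace : \tr A = \sum_(x <- r) x.
Proof.
have [P [d [uP defA defd]]] := sym_diagonalization.
apply: (fmorph_inj f); rewrite -trace_map_mx -/f defA mxtrace_mulC mulmxA.
rewrite mulmxV // mul1mx mxtrace_diag rmorph_sum /=.
by rewrite -(big_map f xpredT id) (perm_big _ defd) big_map big_enum.
Qed.

Lemma sym_trace_sqr : \tr (A *m A) = \sum_(x <- r) x ^+ 2.
Proof.
have [P [d [uP defA defd]]] := sym_diagonalization.
apply: (fmorph_inj f); rewrite -trace_map_mx map_mxM -/f defA.
rewrite !mulmxA mulmxK // mxtrace_mulC !mulmxA mulmxV // mul1mx.
rewrite mulmx_diag mxtrace_diag rmorph_sum /=.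
under [RHS]eq_bigr do rewrite rmorphXn.
rewrite -(big_map f xpredT (fun z => z ^+ 2)) (perm_big _ defd) big_map big_enum.
by apply: eq_bigr => i _; rewrite mxE expr2.
Qed.

(** [A^3 - c A] is similar to the diagonal matrix with entries [d^3 - c d], so it vanishes exactly
    when all of these do. *)
Lemma sym_cube_eqP (c : R) :
  (forall x, x \in r -> x ^+ 3 = c * x) <-> A *m A *m A = c *: A.
Proof.
have [P [d [uP defA defd]]] := sym_diagonalization.
have A3 : map_mx f (A *m A *m A - c *: A) =
    invmx P *m diag_mx (\row_i (d 0 i ^+ 3 - f c * d 0 i)) *m P.
  by rewrite map_mxB map_mxZ !map_mxM; apply: similar_diag_cube.
split=> [r3 | /eqP A3c].
  apply/eqP; rewrite -subr_eq0; apply/eqP; apply: (map_mx_inj (f := f)).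
  rewrite A3 map_mx0 -[RHS](mul0mx _ P) -[X in _ = X *m _](mulmx0 _ (invmx P)).
  congr (_ *m _ *m _); apply/matrixP=> i j; rewrite !mxE.
  have: d 0 i \in map f r by rewrite (perm_mem defd) map_f ?mem_enum.
  case/mapP=> x xr ->; rewrite -rmorphXn r3 // rmorphM subrr.
  by rewrite mul0rn.
move=> x xr; have: f x \in [seq d 0 i | i <- enum 'I_n].
  by rewrite -(perm_mem defd) map_f.
case/mapP=> i _ fx; move: A3c; rewrite -subr_eq0 => /eqP A3c.
move: A3; rewrite A3c map_mx0 => /esym/(congr1 (fun M => P *m M *m invmx P)).
rewrite !mulmxA mulmxV // mul1mx mulmx0 mul0mx mulmxK //.
move=> /matrixP/(_ i i); rewrite !mxE eqxx mulr1n -fx -rmorphXn -rmorphM => /eqP.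
by rewrite subr_eq0 => /eqP/fmorph_inj.
Qed.

End SymmetricSpectrum.

(** * Absolute values and squares of reals with sum zero *)

Section ZeroSum.
Variables (R : rcfType) (r : seq R).
Hypothesis r0 : \sum_(x <- r) x = 0.
Let E := \sum_(x <- r) `|x|.

(** The remaining terms sum to [- x], so they too contribute at least [|x|] to [E]. *)
Lemma zero_sum_norm_le x : x \in r -> `|x| <= E / 2.
Proof.
move=> xr; have := r0; have := erefl E; rewrite {1}/E !(big_rem _ xr) /=.
move=> EE S0; have: `|\sum_(y <- rem x r) y| <= \sum_(y <- rem x r) `|y|.
  exact: ler_norm_sum.
have -> : \sum_(y <- rem x r) y = - x by lra.
by rewrite normrN; lra.
Qed.

Lemma zero_sum_sqr_le : 2 * \sum_(x <- r) x ^+ 2 <= E ^+ 2.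
Proof.
have -> : E ^+ 2 = 2 * \sum_(x <- r) `|x| * (E / 2).
  by rewrite -mulr_suml -/E; field.
rewrite ler_pM2l ?ltr0n // big_seq [X in _ <= X]big_seq ler_sum // => x xr.
by rewrite -real_normK ?num_real // expr2 ler_wpM2l // zero_sum_norm_le.
Qed.

(** The nonnegative terms [|x| (E/2 - |x|)] have sum zero here, so each [|x|] is [0] or [E/2]. *)
Lemma zero_sum_sqr_eq : E ^+ 2 = 2 * \sum_(x <- r) x ^+ 2 ->
  forall x, x \in r -> x ^+ 3 = (E / 2) ^+ 2 * x.
Proof.
move=> E2; have: \sum_(x <- r) `|x| * (E / 2 - `|x|) == 0.
  under eq_bigr do rewrite mulrBr -expr2 real_normK ?num_real //.
  by rewrite sumrB -mulr_suml -/E; apply/eqP; lra.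
rewrite big_seq psumr_eq0 => [|x xr]; last first.
  by rewrite mulr_ge0 // subr_ge0 zero_sum_norm_le.
move=> /allP r3 x xr; have := r3 x xr; rewrite xr /= mulf_eq0 normr_eq0.
case/orP=> [/eqP-> | ]; first by rewrite mulr0 expr0n.
by rewrite subr_eq0 => /eqP->; rewrite real_normK ?num_real // exprSr.
Qed.

End ZeroSum.

Lemma sum_norm_cube_eq (R : rcfType) (r : seq R) (c : R) : 0 <= c ->
    (forall x, x \in r -> x ^+ 3 = c * x) ->
  c * (\sum_(x <- r) `|x|) ^+ 2 = (\sum_(x <- r) x ^+ 2) ^+ 2.
Proof.
move=> c0 r3; rewrite -{1}(sqr_sqrtr c0) -exprMn; congr (_ ^+ 2).
rewrite mulr_sumr; apply: eq_big_seq => x /r3 /eqP.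
have [-> _ | x0] := eqVneq x 0; first by rewrite normr0 mulr0 expr0n.
rewrite exprSr (inj_eq (mulIf x0)) => /eqP <-.
by rewrite sqrtr_sqr -expr2 real_normK ?num_real.
Qed.

(** * Counting incidences and adjacent pairs *)

Section Counting.
Variables (V : finType) (H : hypergraph V).
Local Open Scope nat_scope.

(** The adjacency entries as natural numbers indexed by vertices, so that the counting stays in
    [nat]. *)
Definition mult (u v : V) : nat := if u == v then 0 else codegree H [set u; v].

Lemma codegree_sum (A : {set V}) :
  codegree H A = \sum_(e in edges H) (A \subset e).
Proof.
rewrite /codegree -sum1_card big_mkcond [RHS]big_mkcond /=.
by apply: eq_bigr => e _; rewrite inE; case: (e \in edges H); case: (A \subset e).
Qed.

Lemma mult_sum u v :
  mult u v = \sum_(e in edges H) [&& u != v, u \in e & v \in e].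
Proof.
rewrite /mult; have [-> | uv] := eqVneq u v; first by rewrite big1.
by rewrite codegree_sum; apply: eq_bigr => e _; rewrite subUset !sub1set.
Qed.

Lemma multC u v : mult u v = mult v u.
Proof. by rewrite /mult eq_sym setUC. Qed.

Lemma mult_gt0 u v : (0 < mult u v) = step H u v.
Proof.
rewrite mult_sum lt0n sum_nat_eq0 negb_forall.
apply/existsP/exists_inP=> [[e] | [e eH /and3P[ue ve uv]]]; last first.
  by exists e; rewrite eH uv ue ve.
rewrite negb_imply eqb0 negbK => /andP[eH /and3P[uv ue ve]].
by exists e; rewrite // ue ve.
Qed.

Lemma stepC u v : step H u v = step H v u.
Proof. by rewrite -!mult_gt0 multC. Qed.

Lemma sum_degree : \sum_v degree H v = \sum_(e in edges H) #|e|.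
Proof.
under eq_bigr do rewrite /degree codegree_sum.
rewrite exchange_big /=; apply: eq_bigr => e _.
rewrite -sum1_card [RHS]big_mkcond; apply: eq_bigr => v _.
by rewrite sub1set; case: (v \in e).
Qed.

(** Each edge contributes its ordered pairs of distinct vertices. *)
Lemma sum_mult :
  \sum_u \sum_v mult u v = \sum_(e in edges H) #|e| * #|e|.-1.
Proof.
under eq_bigr do under eq_bigr do rewrite mult_sum.
under eq_bigr do rewrite exchange_big /=.
rewrite exchange_big /=; apply: eq_bigr => e _.
rewrite -sum_nat_const [RHS]big_mkcond; apply: eq_bigr => u _.
case: ifPn => [ue | /negPf ue]; last by rewrite big1 // => v _; rewrite andbF.
rewrite (cardD1 u) ue -sum1_card [RHS]big_mkcond; apply: eq_bigr => v _.
by rewrite !inE eq_sym; case: eqP => //; case: (v \in e).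
Qed.

Lemma corank_le (e : {set V}) : e \in edges H -> corank H <= #|e|.
Proof.
have: e \in index_enum [the finType of {set V}] by rewrite mem_index_enum.
rewrite /corank => er eH; elim: (index_enum _) er => // x r IHr.
rewrite inE big_cons => /predU1P[<- | /IHr le_r]; first by rewrite eH geq_minl.
by case: ifP => // _; rewrite (leq_trans (geq_minr _ _)).
Qed.

Lemma corank_uniform k : uniform H k -> edges H != set0 -> corank H = k.
Proof.
move=> Hk /set0Pn[e eH]; apply/eqP; rewrite eqn_leq -{1}(Hk e eH) corank_le //=.
(* The default [#|V|] of the minimum is at least [k], since some edge has [k] vertices. *)
apply: (big_ind (leq k)) => [|x y kx ky|f /Hk -> //].
  by rewrite -(Hk e eH) max_card.
by rewrite leq_min kx.
Qed.

(** An edge [e] accounts for [(s - 1) |e|] on the left and for [|e| (|e| - 1)] on the right. *)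
Lemma corank_sum_degree_le :
  (corank H).-1 * \sum_v degree H v <= \sum_u \sum_v mult u v.
Proof.
rewrite sum_degree sum_mult big_distrr /=; apply: leq_sum => e eH.
by rewrite mulnC leq_mul2l -!subn1 leq_sub2r ?orbT ?corank_le.
Qed.

(** A natural number is at most its square, with equality exactly for 0 and 1. *)
Lemma sum_mult_sqr_leqif :
  \sum_u \sum_v mult u v <= \sum_u \sum_v mult u v * mult v u
    ?= iff [forall u, forall v, mult u v <= 1].
Proof.
apply: leqif_sum => u _; apply: leqif_sum => v _.
rewrite (multC v); split; first by case: (mult u v) => // m; rewrite leq_pmulr.
by case: (mult u v) => [|[|m]] //; apply: ltn_eqF; rewrite ltn_Pmulr.
Qed.

Lemma mult_uniform2 : uniform H 2 -> forall u v, mult u v <= 1.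
Proof.
move=> H2 u v; rewrite /mult; have [//|uv] := eqVneq u v.
rewrite -(cards1 [set u; v]) subset_leq_card //; apply/subsetP=> e.
by rewrite !inE => /andP[eH uve]; rewrite eq_sym eqEcard uve (H2 e eH) cards2 uv.
Qed.

Lemma mult_step : (forall u v, mult u v <= 1) ->
  forall u v, mult u v = step H u v.
Proof.
by move=> m1 u v; rewrite -mult_gt0; case: (mult u v) (m1 u v) => [|[]].
Qed.

Lemma corank_sum_degree_uniform2 : uniform H 2 ->
  (corank H).-1 * \sum_v degree H v = \sum_u \sum_v mult u v.
Proof.
move=> H2; rewrite sum_degree sum_mult.
(* Without edges the co-rank is the default [#|V|], but both sums are empty. *)
have [H0|Hn0] := eqVneq (edges H) set0; first by rewrite H0 !big_set0 muln0.
by rewrite (corank_uniform H2) // mul1n; apply: eq_bigr => e /H2 ->.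
Qed.

Lemma step_uniform2 u v : uniform H 2 ->
  step H u v = ((u != v) && ([set u; v] \in edges H)).
Proof.
move=> H2; apply/exists_inP/andP=> [[e eH /and3P[ue ve uv]] | [uv uvH]].
  split=> //; suff -> : [set u; v] = e by [].
  by apply/eqP; rewrite eqEcard subUset !sub1set ue ve cards2 uv (H2 e eH).
by exists [set u; v]; rewrite // set21 set22.
Qed.

(* An edge with three vertices spans a triangle. *)
Lemma triangle_free_uniform2 :
  (forall x y z, step H x y -> step H y z -> step H z x -> False) ->
  uniform H 2.
Proof.
move=> noT e eH; apply/eqP; rewrite eqn_leq (edge_card eH) andbT leqNgt.
apply/negP=> /card_gt2P[x [y [z [[xe ye ze] [xy yz zx]]]]].
by apply: (noT x y z); apply/exists_inP; exists e; rewrite // ?xe ?ye ?ze //.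
Qed.

End Counting.

(* Without triangles, at most one of (x, y) and (y, x) is the middle of a walk of
   length 3 from a to b, so the hypothesis on the count forces exactly one. *)
Lemma walk3_dichotomy (V : finType) (g : rel V) (a b : V) :
    symmetric g ->
    (forall x y z, g x y -> g y z -> g z x -> False) ->
    (\sum_x \sum_y g x y = 2 * \sum_x \sum_y g a x * g x y * g y b)%N ->
  forall x y, g x y -> (g a x && g y b) || (g a y && g x b).
Proof.
move=> gC noT eq2.
have le1 x y : (g a x * g x y * g y b + g a y * g y x * g x b <= g x y
    ?= iff (g x y ==> (g a x && g y b) || (g a y && g x b)))%N.
  rewrite (gC y x); case gxy: (g x y); rewrite ?muln0 // !muln1.
  case ax: (g a x); case yb: (g y b); case ay: (g a y); case xb: (g x b) => //;
    by case: (noT a x y); rewrite // gC.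
have [_ eqs] :=
  leqif_sum (fun x (_ : true) => leqif_sum (fun y (_ : true) => le1 x y)).
move=> x y gxy.
have: [forall x, forall y,
         g x y ==> (g a x && g y b) || (g a y && g x b)].
  (* Exchanging [x] and [y] identifies the two sums; hence the factor 2 in the hypothesis. *)
  rewrite -eqs eq2; apply/eqP; under eq_bigr do rewrite big_split.
  by rewrite big_split /= mul2n -addnn; congr addn; rewrite exchange_big.
by move=> /forallP/(_ x)/forallP/(_ y)/implyP/(_ gxy).
Qed.

(** * Matrices of natural numbers indexed by vertices *)

Section VertexMatrix.
Variables (R : rcfType) (V : finType).
Implicit Types F G : V -> V -> nat.

Definition vmx F : 'M[R]_#|V| :=
  \matrix_(i, j) (F (enum_val i) (enum_val j))%:R.

Lemma sum_enum_val (F : V -> nat) :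
  \sum_(i < #|V|) (F (enum_val i))%:R = (\sum_v F v)%:R :> R.
Proof. by rewrite natr_sum (big_enum_val (fun v => (F v)%:R)). Qed.

Lemma vmxM F G : vmx F *m vmx G = vmx (fun u v => \sum_w F u w * G w v)%N.
Proof.
apply/matrixP=> i j; rewrite !mxE -sum_enum_val.
by apply: eq_bigr => k _; rewrite !mxE natrM.
Qed.

Lemma trace_vmx F : \tr (vmx F) = (\sum_v F v v)%:R.
Proof. by rewrite -sum_enum_val; apply: eq_bigr => i _; rewrite mxE. Qed.

Lemma vmxE F u v : vmx F (enum_rank u) (enum_rank v) = (F u v)%:R.
Proof. by rewrite mxE !enum_rankK. Qed.

Lemma adjmx_vmx (H : hypergraph V) : adjmx R H = vmx (mult H).
Proof.
apply/matrixP=> i j; rewrite !mxE /mult (inj_eq enum_val_inj).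
by case: eqP.
Qed.

End VertexMatrix.

(** * Components that contain an edge *)

Section Components.
Variables (V : finType) (H : hypergraph V).

Lemma componentE (C : {set V}) v :
  C \in components H -> v \in C -> C = [set w | connected H v w].
Proof.
have symH : connect_sym (step H) := sym_connect_sym (stepC H).
case/imsetP=> u _ ->; rewrite !inE => /= uv; apply/setP=> w.
by rewrite !inE; apply: (same_connect symH uv).
Qed.

Lemma nontrivial_componentE (C : {set V}) v :
  C \in nontrivial_components H -> v \in C -> C = [set w | connected H v w].
Proof. by rewrite inE => /andP[CH _]; apply: componentE. Qed.

Lemma edge_component (e : {set V}) v (C := [set w | connected H v w]) :
  e \in edges H -> v \in e ->
  C \in nontrivial_components H /\ e \in edges_in H C.
Proof.
move=> eH ve; have eC : e \in edges_in H C.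
  rewrite inE eH; apply/subsetP=> w we; rewrite inE.
  have [<- | vw] := eqVneq v w; first exact: connect0.
  by apply/connect1/exists_inP; exists e; rewrite // ve we.
split=> //; rewrite inE; apply/andP; split; last by apply/set0Pn; exists e.
by apply/imsetP; exists v; rewrite // /C; apply/setP=> w; rewrite !inE.
Qed.

Lemma isolated_notin_components v :
  v \notin cover (nontrivial_components H) -> isolated H v.
Proof.
move=> vN; apply/eqP; rewrite cards_eq0; apply/eqP/setP=> e.
rewrite !inE sub1set; apply: contraNF vN => /andP[eH ve].
have [CH _] := edge_component eH ve.
by apply/bigcupP; exists [set w | connected H v w];
  rewrite // inE /connected connect0.
Qed.

Lemma edge_uniform2 e : uniform H 2 -> e \in edges H ->
  exists a b, e = [set a; b] /\ step H a b.
Proof.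
move=> H2 eH; have /eqP/cards2P[a [b [ab eE]]] := H2 e eH.
by exists a, b; rewrite step_uniform2 // ab -eE.
Qed.

Lemma complete_bipartite_component :
    uniform H 2 ->
    (forall x y z, step H x y -> step H y z -> step H z x -> False) ->
    (forall a b x y, step H a b -> step H x y ->
      (step H a x && step H y b) || (step H a y && step H x b)) ->
  (#|nontrivial_components H| <= 1)%N /\
  forall C, C \in nontrivial_components H -> complete_bipartite H C.
Proof.
move=> H2 noT dich; split.
  apply/card_le1_eqP=> C D CN DN.
  have [/set0Pn[e]] : edges_in H C != set0 by move: CN; rewrite inE => /andP[].
  rewrite inE => /andP[/(edge_uniform2 H2)[a [b [-> ab]]]].
  rewrite subUset !sub1set => /andP[aC _].
  have [/set0Pn[f]] : edges_in H D != set0 by move: DN; rewrite inE => /andP[].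
  rewrite inE => /andP[/(edge_uniform2 H2)[x [y [-> xy]]]].
  rewrite subUset !sub1set => /andP[xD yD].
  rewrite (nontrivial_componentE CN aC).
  (* The vertex [a] is adjacent to an end of the edge chosen in [D], so [C] and [D] share [a]. *)
  have aD : a \in D.
    case/orP: (dich _ _ _ _ ab xy) => /andP[+ _]; rewrite stepC => /connect1 ax.
      by rewrite (nontrivial_componentE DN xD) inE.
    by rewrite (nontrivial_componentE DN yD) inE.
  by rewrite (nontrivial_componentE DN aD).
move=> C CN.
have [/set0Pn[e]] : edges_in H C != set0 by move: CN; rewrite inE => /andP[].
rewrite inE => /andP[/(edge_uniform2 H2)[a [b [-> ab]]]].
rewrite subUset !sub1set => /andP[aC _].
have ba : step H b a by rewrite stepC.
exists [set x | step H b x], [set y | step H a y]; split.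
- by apply/set0Pn; exists a; rewrite inE.
- by apply/set0Pn; exists b; rewrite inE.
- rewrite (nontrivial_componentE CN aC); apply/setP=> w; rewrite !inE.
  apply/orP/idP=> [[bw | aw] | ].
  + exact: connect_trans (connect1 ab) (connect1 bw).
  + exact: connect1.
  (* The dichotomy for [a b] and the last edge of a walk from [a] places its end point in one of the
     parts; the empty walk ends at [a], a neighbour of [b]. *)
  case/connectP=> p; case/lastP: p => [_ ->|p z]; first by left.
  rewrite rcons_path last_rcons => /andP[_ pz] ->.
  case/orP: (dich _ _ _ _ ab pz) => /andP[]; first by left; rewrite stepC.
  by right.
- rewrite -setI_eq0; apply/eqP/setP=> w; rewrite !inE.
  by apply/negP=> /andP[bw aw]; apply: (noT a b w); rewrite // stepC.
apply/setP=> f; rewrite inE; apply/andP/imset2P.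
  case=> /(edge_uniform2 H2)[x [y [-> xy]]] _.
  case/orP: (dich _ _ _ _ ab xy) => /andP[ax yb].
    by exists y x; rewrite ?inE // 1?stepC // setUC.
  by exists x y; rewrite ?inE // stepC.
case=> x y; rewrite !inE => bx ay ->.
have xy : step H x y.
  have xb : step H x b by rewrite stepC.
  (* The other alternative makes [x] adjacent to [a], which gives the triangle [x a b]. *)
  case/orP: (dich _ _ _ _ xb ay) => /andP[]; last by [].
  move=> xa _; case: (noT x a b) => //; by rewrite stepC.
split; first by move: xy; rewrite step_uniform2 // => /andP[].
rewrite subUset !sub1set (nontrivial_componentE CN aC) !inE.
by rewrite /connected (connect1 ay) (connect_trans (connect1 ab) (connect1 bx)).
Qed.

Lemma step_complete_bipartite :
    uniform H 2 -> (#|nontrivial_components H| <= 1)%N ->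
    (forall C, C \in nontrivial_components H -> complete_bipartite H C) ->
  exists X Y : {set V}, [disjoint X & Y] /\
    forall u v, step H u v = (u \in X) && (v \in Y) || (u \in Y) && (v \in X).
Proof.
move=> H2 /card_le1_eqP N1 bip.
have [N0 | /set0Pn[C CN]] := eqVneq (nontrivial_components H) set0.
  (* No component contains an edge, so there is no edge and empty parts describe [step]. *)
  exists set0, set0; rewrite -setI_eq0 set0I; split=> // u v.
  rewrite !inE; apply/exists_inP=> -[e eH /and3P[ue _ _]].
  by have [] := edge_component eH ue; rewrite N0 inE.
have [X [Y [_ _ _ dXY eC]]] := bip C CN.
exists X, Y; split=> // u v.
have XYstep x y : x \in X -> y \in Y -> step H x y.
  move=> xX yY; rewrite step_uniform2 //; apply/andP; split.
    by apply/negP=> /eqP xy; move: (disjointFr dXY xX); rewrite xy yY.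
  have: [set x; y] \in edges_in H C by rewrite eC; apply/imset2P; exists x y.
  by rewrite inE => /andP[].
apply/idP/orP=> [uv | [] /andP[]]; [ | exact: XYstep | ]; last first.
  by move=> uY vX; rewrite stepC; apply: XYstep.
move: (uv); rewrite step_uniform2 // => /andP[neq_uv uvH].
have [DN] := edge_component uvH (set21 u v).
rewrite (N1 _ _ CN DN) eC => /imset2P[x y xX yY uvE].
have: u \in [set x; y] by rewrite -uvE set21.
have: v \in [set x; y] by rewrite -uvE set22.
rewrite !inE => /orP[]/eqP vE /orP[]/eqP uE;
  move: neq_uv; rewrite uE vE ?eqxx // => _.
  by right; rewrite yY.
by left; rewrite xX.
Qed.

End Components.

Lemma sum_card_setX (V : finType) (A B : {set V}) :
  (\sum_u \sum_v (u \in A) * (v \in B) = #|A| * #|B|)%N.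
Proof.
under eq_bigr do rewrite -big_distrr /=.
by rewrite -big_distrl /= -!sum1_card -!big_mkcond.
Qed.

(** * Energy through traces, and the extremal case *)

Section Energy.
Variables (R : rcfType) (V : finType) (H : hypergraph V).
(** [S1] is the sum of the entries of the adjacency matrix, [S2] the trace of its square. *)
Let S1 := (\sum_u \sum_v mult H u v)%N.
Let S2 := (\sum_u \sum_v mult H u v * mult H v u)%N.

Let charA := s2valP' (sym_eigenvalues (adjmx_sym R H)).

Lemma spectrum_sum : \sum_(x <- spectrum R H) x = 0.
Proof.
rewrite -(sym_trace (adjmx_sym R H) charA) adjmx_vmx trace_vmx big1 // => v _.
by rewrite /mult eqxx.
Qed.

Lemma spectrum_sum_sqr : \sum_(x <- spectrum R H) x ^+ 2 = S2%:R.
Proof.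
by rewrite -(sym_trace_sqr (adjmx_sym R H) charA) adjmx_vmx vmxM trace_vmx.
Qed.

Lemma energy_ge0 : 0 <= energy R H.
Proof. exact: sumr_ge0. Qed.

Lemma energy_sqr_ge : (2 * S2)%:R <= energy R H ^+ 2.
Proof. by rewrite natrM -spectrum_sum_sqr zero_sum_sqr_le ?spectrum_sum. Qed.

(** This moves the radicand to [nat]. The truncated [(corank H).-1] agrees with the real difference
    once the co-rank is positive; without vertices or without edges both sides are 0. *)
Lemma radicandE :
  2 * #|V|%:R * ((corank H)%:R - 1) * average_degree R H =
  (2 * ((corank H).-1 * \sum_v degree H v))%:R.
Proof.
have [V0 | Vn0] := eqVneq #|V| 0%N.
  rewrite V0 mulr0 !mul0r big1 ?muln0 // => v _.
  by move: (card0_eq V0 v); rewrite inE.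
have -> : 2 * #|V|%:R * ((corank H)%:R - 1) * average_degree R H =
    2 * (((corank H)%:R - 1) * (\sum_v degree H v)%:R) :> R.
  rewrite /average_degree -natr_sum; field.
  by rewrite pnatr_eq0.
rewrite !natrM; congr (_ * _).
have [H0 | /set0Pn[e eH]] := eqVneq (edges H) set0.
  by rewrite sum_degree H0 big_set0 !mulr0.
suff k0 : (0 < corank H)%N by rewrite -{1}(prednK k0) -addn1 natrD addrK.
apply: (big_ind (leq 1)) => [|x y kx ky|f fH].
- by apply: leq_trans (max_card (mem e)); apply: ltnW (edge_card eH).
- by rewrite leq_min kx.
exact: ltnW (edge_card fH).
Qed.

Lemma extremal_step :
    energy R H ^+ 2 = (2 * S2)%:R -> (forall u v, mult H u v <= 1)%N ->
  (forall x y z, step H x y -> step H y z -> step H z x -> False) /\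
  (forall a b x y, step H a b -> step H x y ->
    (step H a x && step H y b) || (step H a y && step H x b)).
Proof.
move=> E2 m1; set c := (energy R H / 2) ^+ 2.
have S2c : S2%:R = 2 * c by move: E2; rewrite natrM /c => E2; lra.
have A3 : adjmx R H *m adjmx R H *m adjmx R H = c *: adjmx R H.
  apply/(sym_cube_eqP (adjmx_sym R H) charA).
  by apply: zero_sum_sqr_eq; rewrite ?spectrum_sum // spectrum_sum_sqr -natrM.
have noT x y z : step H x y -> step H y z -> step H z x -> False.
  (* The trace of [A^3] counts closed walks of length 3, with multiplicity; a zero sum of natural
     numbers has only zero terms. *)
  have : \tr (adjmx R H *m adjmx R H *m adjmx R H) = 0.
    by rewrite A3 linearZ /= (sym_trace (adjmx_sym R H) charA) spectrum_sum mulr0.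
  rewrite adjmx_vmx !vmxM trace_vmx => /eqP.
  rewrite pnatr_eq0 sum_nat_eq0 => /forallP/(_ x)/=.
  rewrite sum_nat_eq0 => /forallP/(_ z)/=.
  rewrite muln_eq0 sum_nat_eq0 -!mult_gt0 => /orP[/forallP/(_ y) | /eqP->] //=.
  by rewrite muln_eq0 => /orP[]/eqP->.
split=> // a b x y ab; apply: walk3_dichotomy => //; first exact: stepC.
have S2E : S2 = (\sum_x \sum_y step H x y)%N.
  apply: eq_bigr => u _; apply: eq_bigr => v _.
  by rewrite !mult_step // (stepC H v); case: (step H u v).
apply/eqP; rewrite -S2E -(eqr_nat R) S2c natrM; apply/eqP; congr (_ * _).
(* As [a b] is an edge, the [(a, b)] entry of [A^3 = c A] says that [c] is the number of walks of
   length 3 from [a] to [b]; twice this is [S2], the number of ordered adjacent pairs. *)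
have := congr1 (fun M : 'M_#|V| => M (enum_rank a) (enum_rank b)) A3.
rewrite adjmx_vmx !vmxM vmxE [in RHS]mxE vmxE mult_step // ab mulr1 => <-.
congr _%:R; rewrite exchange_big; apply: eq_bigr => v _.
by rewrite big_distrl; apply: eq_bigr => u _; rewrite !mult_step.
Qed.

Lemma energy_bipartite (X Y : {set V}) :
    [disjoint X & Y] -> (forall u v, mult H u v <= 1)%N ->
    (forall u v, step H u v = (u \in X) && (v \in Y) || (u \in Y) && (v \in X)) ->
  energy R H ^+ 2 = (2 * S1)%:R.
Proof.
move=> dXY m1 stepE.
have XY u : (u \in X) && (u \in Y) = false.
  by case uX: (u \in X); rewrite //= (disjointFr dXY uX).
have mE u v : mult H u v = ((u \in X) * (v \in Y) + (u \in Y) * (v \in X))%N.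
  rewrite mult_step // stepE; have := XY u; have := XY v.
  by case: (u \in X); case: (u \in Y); case: (v \in X); case: (v \in Y).
have S1E : S1 = (2 * (#|X| * #|Y|))%N.
  rewrite /S1; under eq_bigr do under eq_bigr do rewrite mE.
  under eq_bigr do rewrite big_split /=.
  by rewrite big_split /= !sum_card_setX; lia.
have S2E : S2 = S1.
  apply/esym/eqP; rewrite (sum_mult_sqr_leqif H).
  by apply/forallP=> u; apply/forallP=> v.
(* A walk of length 2 returns to the part it started from, with its middle vertex in the other
   part. *)
have m2 u y : (\sum_w mult H u w * mult H w y =
    #|Y| * ((u \in X) * (y \in X)) + #|X| * ((u \in Y) * (y \in Y)))%N.
  rewrite -!sum1_card !big_distrl /= [X in (_ = X + _)%N]big_mkcond.
  rewrite [X in (_ = _ + X)%N]big_mkcond -big_split; apply: eq_bigr => w _ /=.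
  rewrite !mE; have := XY w.
  by case: (w \in X); case: (w \in Y); rewrite //= => _; lia.
have A3 : adjmx R H *m adjmx R H *m adjmx R H = (#|X| * #|Y|)%:R *: adjmx R H.
  rewrite adjmx_vmx !vmxM; apply/matrixP=> i j; rewrite !mxE -natrM.
  congr _%:R; set u := enum_val i; set v := enum_val j.
  under eq_bigr => w _ do rewrite m2.
  transitivity (\sum_w ((w \in X) * (#|Y| * (u \in X) * (v \in Y)) +
      (w \in Y) * (#|X| * (u \in Y) * (v \in X))))%N.
    apply: eq_bigr => w _; rewrite mE; have := XY w.
    by case: (w \in X); case: (w \in Y); rewrite //= => _; lia.
  rewrite big_split -!big_distrl /=.
  have cE (A : {set V}) : (\sum_w (w \in A) = #|A|)%N.
    by rewrite -sum1_card -big_mkcond.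
  by rewrite !cE mE; lia.
have r3 := (sym_cube_eqP (adjmx_sym R H) charA _).2 A3.
have := sum_norm_cube_eq (ler0n _ _) r3.
rewrite spectrum_sum_sqr S2E S1E -/(energy R H).
(* If a part is empty, [c = 0] cannot be cancelled, but then every eigenvalue has cube 0. Otherwise
   [c E^2 = (2 c)^2] gives [E^2 = 4 c]. *)
have [c0 _ | c0] := eqVneq (#|X| * #|Y|)%N 0%N.
  rewrite c0 !muln0; apply/eqP; rewrite expf_eq0 /=.
  rewrite /energy big_seq big1 // => x /r3 /eqP.
  by rewrite c0 mul0r expf_eq0 => /eqP->; rewrite normr0.
have c0' : (#|X| * #|Y|)%:R != 0 :> R by rewrite pnatr_eq0.
move: c0'; rewrite (natrM _ 2 (2 * _)) (natrM _ 2 (#|X| * _)).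
set c := (_ * _)%:R => c0' E2.
by apply: (mulfI c0'); rewrite E2; ring.
Qed.

End Energy.

(** * The lower bound and its equality case *)

Theorem theorem26 (R : rcfType) (V : finType) (H : hypergraph V) :
  Num.sqrt (2 * #|V|%:R * ((corank H)%:R - 1) * average_degree R H)
    <= energy R H
  /\ (energy R H
        = Num.sqrt (2 * #|V|%:R * ((corank H)%:R - 1) * average_degree R H)
      <->
      [/\ uniform H 2,
          (#|nontrivial_components H| <= 1)%N,
          forall C : {set V}, C \in nontrivial_components H ->
            complete_bipartite H C
        & forall v : V, v \notin cover (nontrivial_components H) ->
            isolated H v]).
Proof.
(* The energy is nonnegative, hence the root of its square; only the radicands remain to be
   compared. *)
rewrite radicandE -{1 2}(ger0_norm (energy_ge0 R H)) -sqrtr_sqr.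
have le1 := corank_sum_degree_le H; have le2 := sum_mult_sqr_leqif H.
have le3 := energy_sqr_ge R H.
split.
  apply: ler_wsqrtr; apply: le_trans le3.
  by rewrite ler_nat leq_mul2l (leq_trans le1) ?le2.
split=> [/eqP | [H2 N1 bip _]].
  rewrite eqr_sqrt ?ler0n ?sqr_ge0 // => /eqP E2.
  (* Equality closes the chain from [(s - 1)] times the degree sum through [S1] and [S2] to half the
     squared energy, so every link is an equality. *)
  move: (le3); rewrite E2 ler_nat leq_mul2l /= => le4.
  have eq12 := leq_trans le4 le1.
  have /forallP m1 : [forall u, forall v, mult H u v <= 1]%N.
    by rewrite -le2 eqn_leq le2 eq12.
  have {}m1 u v : (mult H u v <= 1)%N by apply/forallP: v.
  have [|noT dich] := extremal_step (R := R) _ m1.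
    rewrite E2; congr (2 * _)%:R; apply/eqP.
    by rewrite eqn_leq le4 (leq_trans le1) ?le2.
  have H2 := triangle_free_uniform2 noT.
  have [N1 bip] := complete_bipartite_component H2 noT dich.
  by split=> // v; apply: isolated_notin_components.
have [X [Y [dXY stepE]]] := step_complete_bipartite H2 N1 bip.
rewrite (energy_bipartite R dXY (mult_uniform2 H2) stepE).
by rewrite corank_sum_degree_uniform2.
Qed.
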